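(* Let $(X,\operatorname{dist})$ be a compact metric space and $f\colon X\to X$ a homeomorphism. Then $f$ is cw-expansive if and only if $f$ is partially expansive with central dimension $D=0$.
   Context: A continuum is a (non-empty) compact connected set. $f$ is cw-expansive if there is $\delta>0$ such that if $C\subset X$ is a continuum and $\operatorname{diam}(f^j(C))<\delta$ for all $j\in\mathbb{Z}$, then $C$ is a singleton (has just one point). A set is non-trivial if it has more than one point. Given an integer $D\geq -1$, $f$ is partially expansive with central dimension $D$ if there is $\epsilon>0$ such that for every non-trivial compact set $C\subset X$ with $\dim(C)>D$ there is $k\in\mathbb{Z}$ with $\operatorname{diam}(f^k(C))\geq\epsilon$. Here $\dim$ is the topological (covering) dimension. *)

(* Defs.v *)
From HB Require Import structures.
From mathcomp Require Import all_boot all_order all_algebra.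
From mathcomp Require Import all_classical all_reals all_analysis.

Set Implicit Arguments.
Unset Strict Implicit.
Unset Printing Implicit Defensive.

Import Order.TTheory GRing.Theory Num.Theory.
Import numFieldNormedType.Exports.

Local Open Scope classical_set_scope.
Local Open Scope ring_scope.
Local Open Scope card_scope.

Definition homeomorphism (X Y : topologicalType) (f : X -> Y) : Prop :=
  continuous f /\ exists g : Y -> X, [/\ cancel f g, cancel g f & continuous g].

(* The set f^j(C), j : int. For j < 0 it is the preimage of C under the |j|-th
   iterate of f, which is the image of C under the |j|-th iterate of the
   inverse of f when f is bijective. *)
Definition iterz_image (X : Type) (f : X -> X) (j : int) (C : set X) : set X :=
  match j with
  | Posz n => iter n f @` C
  | Negz n => iter n.+1 f @^-1` C
  end.

(* Extended-real valued, so that an unbounded set has diameter +oo; the value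
   on the empty set is -oo. *)
Definition diam (R : realType) (X : metricType R) (A : set X) : \bar R :=
  ereal_sup [set (mdist p.1 p.2)%:E | p in A `*` A].

Definition open_cover (T : topologicalType) (U : set (set T)) : Prop :=
  U `<=` open /\ cover U id = [set: T].

Definition refines (T : Type) (V U : set (set T)) : Prop :=
  forall B, V B -> exists2 A, U A & B `<=` A.

Definition multiplicity_le (T : Type) (k : nat) (V : set (set T)) : Prop :=
  forall x : T, [set B | V B /\ B x] #<= `I_k.

(* [covering_bound T k] means dim T <= k - 1; thus k = 0 is the case of
   dimension -1, which characterizes the empty space. *)
Definition covering_bound (T : topologicalType) (k : nat) : Prop :=
  forall U : set (set T), finite_set U -> open_cover U ->
  exists V : set (set T),
    [/\ finite_set V, open_cover V, refines V U & multiplicity_le k V].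

(* Lebesgue covering dimension: the least integer n >= -1 such that every
   finite open cover has a finite open refinement in which no point belongs
   to more than n + 1 members, and +oo if there is no such n. *)
Definition covdim (R : realType) (T : topologicalType) : \bar R :=
  ereal_inf [set (k%:R - 1)%:E | k in [set k : nat | covering_bound T k]].

Definition continuum (T : topologicalType) (C : set T) : Prop :=
  [/\ C !=set0, compact C & connected C].

Definition nontrivial_set (T : Type) (C : set T) : Prop :=
  exists x y, [/\ C x, C y & x <> y].

Definition cw_expansive (R : realType) (X : metricType R) (f : X -> X) : Prop :=
  exists2 delta : R, 0 < delta &
    forall C : set X, continuum C ->
      (forall j : int, (diam (iterz_image f j C) < delta%:E)%E) ->
      exists x, C = [set x].

(* The central dimension D is meant to be at least -1. The dimension of C is
   that of the type [set_type C] with the subspace topology. *)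
Definition partially_expansive (R : realType) (X : metricType R) (D : int)
    (f : X -> X) : Prop :=
  exists2 eps : R, 0 < eps &
    forall C : set X, nontrivial_set C -> compact C ->
      ((D%:~R)%:E < covdim R (set_type C))%E ->
      exists k : int, (eps%:E <= diam (iterz_image f k C))%E.

(* Main.v *)
Require Import Defs.
From mathcomp Require Import all_boot all_order all_algebra.
From mathcomp Require Import all_classical all_reals all_analysis.

Local Open Scope classical_set_scope.
Local Open Scope ring_scope.

Import Order.TTheory GRing.Theory Num.Theory.

(** For a compact Hausdorff space, having covering dimension greater than 0
    is the same as containing a continuum with more than one point; once this
    is known, both notions of expansivity quantify over the same sets up to
    passing to a subset, and the same constant serves for both. Indeed, a
    non-trivial continuum is itself a non-trivial compact set of positive
    dimension, while a compact set C of positive dimension contains a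
    non-trivial continuum K, and diam(f^j(K)) <= diam(f^j(C)) for all j.

    A connected space with two points x and y does not have dimension 0: a
    partition into open sets that refines the cover by the complements of x
    and of y would have to be the single whole space
    ([connected_covering_bound1]).

    Conversely, a compact Hausdorff space in which every component is a
    singleton has dimension at most 0. The key is that in such a space the
    intersection of the clopen sets around a point is connected
    ([connected_quasicomponent]), hence is a point here. By compactness the
    clopen sets then form a base, and a finite cover by clopen sets can be made
    disjoint by successive subtraction ([zero_dimensional_covering_bound]). *)

Set Implicit Arguments.
Unset Strict Implicit.
Unset Printing Implicit Defensive.

Local Open Scope card_scope.

(** * Components of compact Hausdorff spaces *)

(** Compactness as an induction principle, replacing the choice of finite
    subcovers: if the conclusion failed, the complements of the sets with
    property [P] would form a proper filter, and near a cluster point of this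
    filter the local hypothesis is contradicted. *)
Lemma compact_set_ind (T : topologicalType) (P : set (set T)) :
  compact [set: T] -> P set0 ->
  (forall A B, P A -> P B -> P (A `|` B)) ->
  (forall A B, A `<=` B -> P B -> P A) ->
  (forall x : T, exists2 N, nbhs x N & P N) ->
  P [set: T].
Proof.
move=> cT P0 PU Psub Ploc; apply: contrapT => nPT.
pose F : set_system T := [set A | P (~` A)].
have FF : ProperFilter F.
  split; first by rewrite /F /= setC0.
  split; first by rewrite /F /= setCT.
  - by move=> A B FA FB; rewrite /F /= setCI; exact: PU.
  - by move=> A B AB; apply: Psub; exact: subsetC.
have [x [_ Fx]] := cT F FF filterT.
have [N Nx PN] := Ploc x.
have FN : F (~` N) by rewrite /F /= setCK.
by have [y []] := Fx _ _ FN Nx.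
Qed.

(** Finitely many of the separating clopen sets suffice to exclude the
    compact complement of [U]; their intersection is the required set. *)
Lemma clopen_sub_open (T : topologicalType) (x : T) (U : set T) :
  compact [set: T] -> open U ->
  (forall y, ~ U y -> exists D, [/\ clopen D, D x & ~ D y]) ->
  exists D, [/\ clopen D, D x & D `<=` U].
Proof.
move=> cT oU sep.
suff [D [cD Dx DU]] : exists D, [/\ clopen D, D x & D `&` setT `<=` U].
  by exists D; split => //; rewrite setIT in DU.
(* The induction is on the set on which D is already known to lie in U. *)
pattern [set: T]; apply: compact_set_ind => //.
- by exists setT; split => //; [exact: clopenT|rewrite setI0].
- move=> A B [D [cD Dx DA]] [E [cE Ex EB]]; exists (D `&` E).
  split; [exact: clopenI|by []|].
  by move=> y [[Dy Ey] [Ay|By]]; [exact: DA|exact: EB].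
- move=> A B AB [D [cD Dx DB]]; exists D; split => // y [Dy /AB By].
  exact: DB.
- move=> y; have [Uy|nUy] := pselect (U y).
    exists U; first by apply: open_nbhs_nbhs; split.
    by exists setT; split; [exact: clopenT|by []|move=> z []].
  have [D [cD Dx nDy]] := sep y nUy.
  exists (~` D).
    by apply: open_nbhs_nbhs; split => //; apply: closed_openC; case: cD.
  by exists D; split => // z [].
Qed.

(** If the quasicomponent [Q] of [x] split into disjoint closed sets [A] and
    [B], normality would give disjoint open sets around them, and some clopen
    set [D] around [x] would lie in their union. The trace of [D] on the open
    set around [A] is then clopen, contains [x] and misses [B], so that [B]
    has to be empty. *)
Lemma connected_quasicomponent (T : topologicalType) (x : T) :
  hausdorff_space T -> compact [set: T] ->
  connected [set y | forall D, clopen D -> D x -> D y].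
Proof.
move=> hT cT; set Q := (X in connected X).
have clQ : closed Q.
  rewrite (_ : Q = \bigcap_(D in [set D | clopen D /\ D x]) D).
    by apply: closed_bigI => D [[_ ?] _].
  by apply/seteqP; split=> y Qy D; [case=> ? ?; exact: Qy|move=> ? ?; exact: Qy].
have Qx : Q x by move=> D.
suff nosep A B : closed A -> closed B -> Q = A `|` B -> A `&` B = set0 ->
    A x -> B = set0.
  move=> B [b Bb] [W oW BW] [F cF BF].
  have cB : closed B by rewrite BF; exact: closedI.
  have cC : closed (Q `\` B).
    rewrite (_ : Q `\` B = Q `&` ~` W).
      by apply: closedI => //; exact: open_closedC.
    rewrite BW; apply/seteqP; split=> y [Qy].
      by move=> n; split => // Wy; exact: n.
    by move=> n; split => // -[_ /n].
  have BQ : B `<=` Q by rewrite BF => y [].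
  (* The two parts are interchangeable, except that x lies in the first. *)
  have [Bx|nBx] := pselect (B x).
    apply/seteqP; split => // y Qy; apply: contrapT => nBy.
    have := nosep B (Q `\` B) cB cC; rewrite setDUK// setDIK => /(_ erefl erefl Bx).
    by move=> QB0; have : set0 y by rewrite -QB0.
  have := nosep (Q `\` B) B cC cB.
  rewrite setUC setDUK// setIC setDIK => /(_ erefl erefl (conj Qx nBx)) B0.
  by move: Bb; rewrite B0.
move=> cA cB QE AB0 Ax.
have nB : set_nbhs A (~` B).
  apply/set_nbhsP; exists (~` B); split => //; first exact: closed_openC.
  exact/disjoints_subset.
have [N /set_nbhsP[U [oU AU UN]] NB] := compact_normal hT cT cA nB.
(* U and the complement of the closure of N are the disjoint open sets that
   separate A from B. *)
have clV : open (~` closure N) by apply: closed_openC; exact: closed_closure.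
have BV : B `<=` ~` closure N by move=> y By /NB.
have [|y nUVy|D [cD Dx DUV]] := @clopen_sub_open T x (U `|` ~` closure N) cT.
- exact: openU.
- have : ~ Q y by rewrite QE => -[/AU|/BV] ?; apply: nUVy; [left|right].
  by move=> /existsNP[D] /not_implyP[cD] /not_implyP[Dx nDy]; exists D.
- (* This second description of the trace shows that it is closed. *)
  have DUE : D `&` U = D `&` closure N.
    apply/seteqP; split=> y [Dy].
      by move=> /UN /subset_closure.
    by move=> Ny; split => //; case: (DUV y Dy).
  have cDU : clopen (D `&` U).
    split; first by apply: openI => //; case: cD.
    rewrite DUE; apply: closedI; first by case: cD.
    exact: closed_closure.
  apply/seteqP; split=> // y By.
  have Qy : Q y by rewrite QE; right.
  have [_ Uy] := Qy _ cDU (conj Dx (AU _ Ax)).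
  exact: BV By (subset_closure (UN _ Uy)).
Qed.

Lemma totally_disconnected_zero_dimensional (T : topologicalType) :
  hausdorff_space T -> compact [set: T] ->
  totally_disconnected [set: T] -> zero_dimensional T.
Proof.
move=> hT cT tdT x y xy; apply: contrapT => nsep.
suff : connected_component [set: T] x y.
  by rewrite tdT//= => yx; rewrite yx eqxx in xy.
have cQ := @connected_quasicomponent T x hT cT.
apply: (connected_component_max _ _ cQ) => // D cD Dx.
by apply: contrapT => nDy; apply: nsep; exists D.
Qed.

Lemma zero_dimensional_clopen_base (T : topologicalType) (x : T) (U : set T) :
  compact [set: T] -> zero_dimensional T -> open U -> U x ->
  exists D, [/\ clopen D, D x & D `<=` U].
Proof.
move=> cT zT oU Ux; apply: clopen_sub_open => // y nUy; apply: zT.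
by apply: contra_notN nUy => /eqP <-.
Qed.

(** * Covering dimension 0 *)

Lemma multiplicity_le1P (T : Type) (V : set (set T)) :
  multiplicity_le 1 V <->
  (forall x B C, V B -> V C -> B x -> C x -> B = C).
Proof.
split=> [m1 x B C VB VC Bx Cx|triv x].
  have /pfcard_geP[E0|[g]] := m1 x.
    by have : [set B | V B /\ B x] B by []; rewrite E0.
  have [[|//] _ <-] := @surj _ _ _ _ g B (conj VB Bx).
  by have [[|//] _ <-] := @surj _ _ _ _ g C (conj VC Cx).
have [[B [VB Bx]]|n] := pselect (exists B, V B /\ B x); last first.
  rewrite (_ : [set B | _] = set0); first exact: card_ge0.
  by apply/seteqP; split=> // B VB; apply: n; exists B.
apply: (card_le_trans (B := [set (fun=> B) i | i in `I_1])); last exact: card_image_le.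
by apply: subset_card_le => C [VC Cx]; exists 0%N => //; exact: triv VB VC Bx Cx.
Qed.

(** Open partitions refining [U] are built over larger and larger clopen sets
    by compactness. To glue two of them, the clopen set [D] covered by the
    first is subtracted from each member of the second. *)
Lemma zero_dimensional_covering_bound (T : topologicalType) :
  compact [set: T] -> zero_dimensional T -> covering_bound T 1.
Proof.
move=> cT zT U _ [oU cU].
pose P (A : set T) := exists D V, [/\ clopen D, A `<=` D, cover V id = D,
  finite_set V & [/\ V `<=` open, refines V U & multiplicity_le 1 V]].
suff [D [V [_ TD VD fV [oV VU mV]]]] : P [set: T].
  exists V; split => //; split => //.
  by apply/seteqP; split => // x _; rewrite VD; exact: TD.
apply: compact_set_ind => //.
- exists set0, set0; split => //.
  + exact: clopen0.
  + exact: bigcup_set0.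
  + by split => //; apply/multiplicity_le1P.
- move=> A B [D [V [cD AD VD fV [oV VU /multiplicity_le1P mV]]]].
  move=> [E [W [cE BE WE fW [oW WU /multiplicity_le1P mW]]]].
  exists (D `|` E), (V `|` [set C `\` D | C in W]); split.
  + exact: clopenU.
  + exact: setUSS.
  + rewrite /cover bigcup_setU -/(cover V id) VD; apply/seteqP; split=> y.
      move=> [|[_ [C WC <-]] [Cy _]]; first by left.
      by right; rewrite -WE; exists C.
    have [Dy _|nDy [//|]] := pselect (D y); first by left.
    rewrite -WE => -[C WC Cy]; right; exists (C `\` D) => //.
    by exists C.
  + by rewrite finite_setU; split => //; exact: finite_image.
  + split.
    * move=> _ [/oV//|[C WC <-]]; rewrite setDE; apply: openI; first exact: oW.
      by apply: closed_openC; case: cD.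
    * move=> _ [/VU//|[C WC <-]]; have [S US CS] := WU _ WC.
      by exists S => // y [/CS].
    * have VsubD C : V C -> C `<=` D by move=> VC y Cy; rewrite -VD; exists C.
      apply/multiplicity_le1P => y B1 B2 [VB1|[C1 WC1 <-]] [VB2|[C2 WC2 <-]] /=.
      - by move=> ? ?; exact: (mV y).
      - by move=> /(VsubD _ VB1) Dy [].
      - by move=> [_ nDy] /(VsubD _ VB2).
      - by move=> [C1y _] [C2y _]; rewrite (mW y C1 C2).
- move=> A B AB [D [V [cD BD *]]]; exists D, V; split => //.
  exact: subset_trans BD.
- move=> x; have : cover U id x by rewrite cU.
  move=> [S US Sx].
  have [D [cD Dx DS]] := @zero_dimensional_clopen_base T x S cT zT (oU _ US) Sx.
  exists D; first by apply: open_nbhs_nbhs; split => //; case: cD.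
  exists D, [set D]; split => //.
  + by rewrite /cover bigcup_set1.
  + split; [by move=> _ ->; case: cD|by move=> _ ->; exists S|].
    by apply/multiplicity_le1P => y _ _ -> ->.
Qed.

(** A member of a disjoint open cover is clopen, because its complement is the
    union of the other members; by connectedness it is the whole space. This
    is incompatible with refining the cover by the complements of two
    points. *)
Lemma connected_covering_bound1 (T : topologicalType) (x y : T) :
  hausdorff_space T -> connected [set: T] -> covering_bound T 1 -> x = y.
Proof.
move=> hT coT b1; apply: contrapT => xy.
have op (z : T) : open (~` [set z]).
  by apply: closed_openC; apply: accessible_closed_set1; exact: hausdorff_accessible.
have [||V [_ [oV cV] VU /multiplicity_le1P mV]] := b1 [set ~` [set x]; ~` [set y]].
- by rewrite finite_setU; split; exact: finite_set1.
- split; first by move=> _ [->|->]; exact: op.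
  apply/seteqP; split => // z _; have [->|zx] := pselect (z = x).
    by exists (~` [set y]); [right|].
  by exists (~` [set x]); [left|].
have [B VB Bx] : cover V id x by rewrite cV.
suff BT : B = setT.
  have [S + BS] := VU _ VB; rewrite BT in BS.
  by move=> [] SE; rewrite SE in BS; [exact: (BS x)|exact: (BS y)].
apply: coT; [by exists x|by exists B; [exact: oV|rewrite setTI]|].
exists B; last by rewrite setTI.
rewrite (_ : B = ~` \bigcup_(C in [set C | V C /\ C <> B]) C).
  by apply: open_closedC; apply: bigcup_open => C [/oV].
apply/seteqP; split=> z.
  by move=> Bz [C [VC CB] Cz]; apply: CB; exact: mV Cz Bz.
move=> nz; have [C VC Cz] : cover V id z by rewrite cV.
have [<-//|CB] := pselect (C = B).
by exfalso; apply: nz; exists C.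
Qed.

Lemma covdim_le0 (R : realType) (T : topologicalType) :
  covering_bound T 1 -> (covdim R T <= 0)%E.
Proof.
by move=> b1; apply: ereal_inf_lbound; exists 1%N => //; rewrite subrr.
Qed.

(** Being inhabited excludes dimension -1, so the infimum that defines the
    dimension ranges over integers that are at least 1. *)
Lemma covdim_gt0 (R : realType) (T : topologicalType) (x : T) :
  ~ covering_bound T 1 -> (0 < covdim R T)%E.
Proof.
move=> nb1; apply: (@lt_le_trans _ _ 1%E); first exact: lte01.
apply: le_ereal_inf_tmp => _ [[|[|k]] bk <-] //.
- have [||V [_ [_ cV] _ mV]] := bk [set setT]; first exact: finite_set1.
    split; first by move=> _ ->; exact: openT.
    by rewrite /cover bigcup_set1.
  have [B VB Bx] : cover V id x by rewrite cV.
  have := mV x; rewrite II0 card_le0 => /eqP E0.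
  by have : [set B | V B /\ B x] B by []; rewrite E0.
- by rewrite lee_fin -natr1 addrK ler1n.
Qed.

(** * Subsets as topological spaces *)

Section subtype.
Context (T : topologicalType) (C : set T).

Lemma continuous_set_val : continuous (set_val : set_type C -> T).
Proof. exact: initial_continuous. Qed.

Lemma hausdorff_set_type : hausdorff_space T -> hausdorff_space (set_type C).
Proof.
move=> hT p q pq; apply: val_inj; apply: hT => A B Ap Bq.
have [z [Az Bz]] := pq _ _ (continuous_set_val Ap) (continuous_set_val Bq).
by exists (set_val z).
Qed.

Lemma compact_set_type : compact C -> compact [set: set_type C].
Proof.
move=> cC F FF _.
have [|x [Cx Fx]] := cC (set_val @ F).
  by apply: (@filterS _ F _ setT) => [z _|]; [exact: set_valP|exact: filterT].
exists (SigSub (mem_set Cx)); split => // A B FA [_ [[W oW <-] Wx] WB].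
have FA' : (set_val @ F) [set set_val z | z in A].
  by apply: (@filterS _ F _ A) => // z Az; exists z.
have [|_ [[z Az <-] Wz]] := Fx _ W FA'; first exact: open_nbhs_nbhs.
by exists z; split => //; exact: WB.
Qed.

Lemma connected_set_type : connected C -> connected [set: set_type C].
Proof.
move=> coC B [b Bb] [_ [W oW <-] BW] [F' /closed_openC[F oF FE] BF].
have imE (D : set T) : B = setT `&` set_val @^-1` D -> set_val @` B = C `&` D.
  move=> ->; apply/seteqP; split=> [_ [z [_ Dz] <-]|y [Cy Dy]].
    by split => //; exact: set_valP.
  by exists (SigSub (mem_set Cy)).
have vBC : set_val @` B = C.
  apply: coC; first by exists (set_val b), b.
    by exists W; [|exact: imE].
  exists (~` F); first exact: open_closedC.
  apply: imE; rewrite BF; congr (_ `&` _).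
  by rewrite -preimage_setC FE setCK.
apply/seteqP; split => // z _.
have [y By /val_inj <- //] : (set_val @` B) (set_val z).
by rewrite vBC; exact: set_valP.
Qed.

End subtype.

(** * Expansivity *)

Lemma iterz_imageS (X : Type) (f : X -> X) (j : int) (A B : set X) :
  A `<=` B -> iterz_image f j A `<=` iterz_image f j B.
Proof.
by move=> AB; case: j => n; [exact: image_subset|exact: preimage_subset].
Qed.

Lemma diamS (R : realType) (X : metricType R) (A B : set X) :
  A `<=` B -> (diam A <= diam B)%E.
Proof.
by move=> AB; apply: ereal_sup_le; apply: image_subset => p [/AB ? /AB ?].
Qed.

(** If there were no such [K], the components of [C] would be singletons and
    [C] would have dimension at most 0. *)
Lemma covdim_gt0_nontrivial_continuum (R : realType) (T : topologicalType)
    (C : set T) :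
  hausdorff_space T -> compact C -> (0 < covdim R (set_type C))%E ->
  exists2 K, K `<=` C & continuum K /\ nontrivial_set K.
Proof.
move=> hT cC dC; apply: contrapT => noK.
have hS : hausdorff_space (set_type C) by exact: hausdorff_set_type.
have cS : compact [set: set_type C] by exact: compact_set_type.
have tS : totally_disconnected [set: set_type C].
  move=> x _; apply/seteqP; split; last first.
    by move=> _ ->; exact: connected_component_refl.
  move=> y xy; apply: contrapT => yx; apply: noK.
  pose K0 := connected_component [set: set_type C] x.
  have cv : {within K0, continuous (set_val : set_type C -> T)}.
    by apply: continuous_subspaceT; exact: continuous_set_val.
  exists (set_val @` K0); first by move=> _ [z _ <-]; exact: set_valP.
  split.
    split.
    - by exists (set_val y), y.
    - apply: continuous_compact => //; apply: subclosed_compact cS _ => //.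
      exact: component_closed closedT.
    - by apply: connected_continuous_connected cv; exact: component_connected.
  exists (set_val x), (set_val y); split.
  - by exists x => //; exact: connected_component_refl.
  - by exists y.
  - by move/val_inj => xy'; apply: yx.
have zS := totally_disconnected_zero_dimensional hS cS tS.
have := covdim_le0 R (zero_dimensional_covering_bound cS zS).
by rewrite leNgt dC.
Qed.

Lemma nontrivial_connected_covdim_gt0 (R : realType) (T : topologicalType)
    (C : set T) :
  hausdorff_space T -> connected C -> nontrivial_set C ->
  (0 < covdim R (set_type C))%E.
Proof.
move=> hT coC [x [y [Cx Cy xy]]].
pose x' : set_type C := SigSub (mem_set Cx).
pose y' : set_type C := SigSub (mem_set Cy).
apply: (covdim_gt0 R x') => b1; apply: xy.
have := connected_covering_bound1 x' y' (hausdorff_set_type hT)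
  (connected_set_type coC) b1.
by move/(congr1 set_val).
Qed.

Theorem proposition2p7 (R : realType) (X : metricType R) (f : X -> X) :
  compact [set: X] -> homeomorphism f ->
  cw_expansive f <-> partially_expansive 0 f.
Proof.
move=> _ _; have hX := @metric_hausdorff R X.
split=> -[d d0 expf]; exists d => // C.
- move=> _ cC dC; apply: contrapT => small.
  have [K KC [cK [x [y [Kx Ky xy]]]]] := covdim_gt0_nontrivial_continuum hX cC dC.
  have [j|z Kz] := expf K cK.
    apply: le_lt_trans (diamS (iterz_imageS KC)) _.
    by rewrite ltNge; apply/negP => dj; apply: small; exists j.
  by move: Kx Ky xy; rewrite Kz => -> ->.
- move=> [[x Cx] cC coC] small; exists x.
  apply/seteqP; split; last by move=> _ ->.
  move=> y Cy; apply: contrapT => yx.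
  have ntC : nontrivial_set C by exists y, x; split.
  have [j] := expf C ntC cC (nontrivial_connected_covdim_gt0 R hX coC ntC).
  by rewrite leNgt small.
Qed.
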